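(* Let $n\ge 1$ be an integer. For any graph $G=(M,E)$ with $\Delta(G)\ge n$, there is a problem instance $([n],M,V,G)$ that has no EF1 allocation.
   Context: A problem instance is a quadruple $(N,M,V,G)$, where $N$ is a finite set of $n$ agents, $M$ is a finite set of $m$ items, $V$ is a family of additive valuation functions $v_i:2^M\to\mathbb{R}_{\ge 0}$, $i\in N$ (write $v_{ij}=v_i(\{j\})$), and $G=(M,E)$ is an undirected (simple) conflict graph on the items. Here $[n]=\{1,\dots,n\}$. An allocation is an ordered partition $A=\langle A_i\rangle_{i\in N}$ of all of $M$ into $|N|$ (possibly empty) bundles; it is feasible if every bundle is an independent set of $G$. A feasible allocation $A$ is EF1 (envy-free up to one good) if for all $i,i'\in N$ with $A_{i'}\neq\emptyset$, $v_i(A_i)\ge v_i(A_{i'})-\max_{j\in A_{i'}}v_{ij}$. (In particular, an instance with no feasible allocation has no EF1 allocation.) $\Delta(G)$ is the maximum degree of $G$. *)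

(* Defs.v *)
From HB Require Import structures.
From mathcomp Require Import all_boot all_order all_algebra.
From mathcomp Require Import reals.

Set Implicit Arguments.
Unset Strict Implicit.
Unset Printing Implicit Defensive.

Import Order.TTheory GRing.Theory Num.Theory.

Local Open Scope ring_scope.

Record sgraph (M : finType) := SGraph {
  edge :> rel M;
  edge_sym : symmetric edge;
  edge_irr : irreflexive edge }.

Definition degree (M : finType) (G : sgraph M) (x : M) : nat :=
  #|[set y | G x y]|.

Definition max_degree (M : finType) (G : sgraph M) : nat :=
  (\max_(x : M) degree G x)%N.

Definition independent (M : finType) (G : sgraph M) (S : {set M}) : Prop :=
  {in S &, forall x y, ~~ G x y}.

Record additive_valuation (R : realType) (M : finType) := AdditiveValuation {
  val_fun :> {set M} -> R;
  val_ge0 : forall S, 0 <= val_fun S;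
  val_additive : forall S, val_fun S = \sum_(j in S) val_fun [set j] }.

Record instance (R : realType) := Instance {
  agents : finType;
  items : finType;
  valuation : agents -> additive_valuation R items;
  conflict : sgraph items }.

Section Allocations.
Variables (R : realType) (I : instance R).

Record allocation := Allocation {
  bundle :> agents I -> {set items I};
  bundle_cover : \bigcup_i bundle i = [set: items I];
  bundle_disjoint : forall i i', i != i' -> [disjoint bundle i & bundle i'] }.

Definition feasible (A : allocation) : Prop :=
  forall i, independent (conflict I) (A i).

(* Valuations are nonnegative, so the default value 0 of the iterated maximum
   does not affect its value on a nonempty bundle. *)
Definition EF1 (A : allocation) : Prop :=
  feasible A /\
  forall i i', A i' != set0 ->
    valuation i (A i) >=
    valuation i (A i') - \big[Num.max/0]_(j in A i') valuation i [set j].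

End Allocations.

(* Main.v *)
(** All agents share the same valuation: fix a vertex [x] with at least [n]
    neighbours and let a bundle be worth the number of neighbours of [x] it
    contains. The agent receiving [x] gets value 0, so under EF1 no bundle
    contains two neighbours of [x]. The remaining [n - 1] bundles thus cover at
    most [n - 1] neighbours, a contradiction. *)
Require Import Defs.
From mathcomp Require Import all_boot all_order all_algebra.
From mathcomp Require Import reals.

Set Implicit Arguments.
Unset Strict Implicit.
Unset Printing Implicit Defensive.

Import Order.TTheory GRing.Theory Num.Theory.

Section CountingValuation.
Variables (R : realType) (M : finType) (S : {set M}).

Definition count_in (T : {set M}) : R := #|T :&: S|%:R%R.

Lemma count_in_ge0 (T : {set M}) : (0 <= count_in T)%R.
Proof. exact: ler0n. Qed.

Lemma count_in1 (j : M) : count_in [set j] = (j \in S)%:R%R.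
Proof.
rewrite /count_in; case: (boolP (j \in S)) => jS.
  by rewrite (setIidPl _) ?sub1set // cards1.
by rewrite (_ : _ :&: _ = set0) ?cards0 //; apply/disjoint_setI0; rewrite disjoints1.
Qed.

Lemma count_in_additive (T : {set M}) :
  count_in T = (\sum_(j in T) count_in [set j])%R.
Proof.
under eq_bigr do rewrite count_in1.
rewrite -natr_sum -big_mkcondr /= sum1_card /count_in.
by congr (_%:R)%R; apply: eq_card => j; rewrite !inE.
Qed.

Definition counting_valuation : additive_valuation R M :=
  AdditiveValuation count_in_ge0 count_in_additive.

End CountingValuation.

(** Double counting: covering puts each element of [S] in some bundle and disjointness in no other,
    so its memberships sum to 1; the two sums are then exchanged. *)
Lemma card_sum_bundles (R : realType) (I : instance R) (A : allocation I)
  (S : {set items I}) : #|S| = \sum_i #|A i :&: S|.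
Proof.
transitivity (\sum_(y in S) \sum_i (y \in A i)).
  rewrite -sum1_card; apply: eq_bigr => y _.
  have /bigcupP[i _ yi]: y \in \bigcup_i A i by rewrite bundle_cover inE.
  rewrite (bigD1 i) //= yi big1 // => k ki.
  by rewrite (disjointFl (bundle_disjoint A ki) yi).
rewrite exchange_big /=; apply: eq_bigr => i _.
rewrite -big_mkcondr /= sum1_card.
by apply: eq_card => y; rewrite !inE andbC.
Qed.

(** Positivity of [n] rules out an empty [M], whose maximum degree is 0 by default although it has
    no vertex to serve as witness. *)
Lemma max_degree_ge (M : finType) (G : sgraph M) (n : nat) :
  0 < n -> n <= max_degree G -> exists x, n <= degree G x.
Proof.
case: n => // n _ hG; apply/existsP; apply: contraLR hG => /existsPn deg_le.
by rewrite -leqNgt; apply/bigmax_leqP => x _; rewrite leqNgt.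
Qed.

Theorem proposition1 (R : realType) (n : nat) (hn : (1 <= n)%N)
  (M : finType) (G : sgraph M) (hG : (n <= max_degree G)%N) :
  exists V : 'I_n -> additive_valuation R M,
    ~ exists A : allocation (Instance V G), EF1 A.
Proof.
have [x] := max_degree_ge hn hG; rewrite /degree; set S := finset _ => leS.
exists (fun=> counting_valuation R S) => -[A [Afeas Aef1]].
have /bigcupP[/= i0 _ xi0]: x \in \bigcup_i A i by rewrite bundle_cover inE.
(* [A i0] is independent and contains [x], hence no neighbour of [x]. *)
have Si0 : #|A i0 :&: S| = 0.
  apply: eq_card0 => y; rewrite !inE; apply/negP => /andP[yi0 xy].
  by have /negP := Afeas i0 _ _ xi0 yi0; apply.
have le1 i : #|A i :&: S| <= 1.
  have [->|Ai0] := eqVneq (A i) set0; first by rewrite set0I cards0.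
  (* As [i0] values its own bundle at 0, EF1 bounds its value for [A i] by that of a single item,
     which is 0 or 1. *)
  have := Aef1 i0 i Ai0; rewrite /= /count_in Si0 subr_le0 => Ai_le.
  rewrite -(ler_nat R); apply: le_trans Ai_le _.
  apply: bigmax_le => [|j _]; first exact: ler01.
  by rewrite [X in (X <= _)%R]count_in1 ler_nat leq_b1.
move: leS; rewrite leqNgt => /negP[].
rewrite (card_sum_bundles A S) (bigD1 i0) //= Si0 add0n.
(* The agents other than [i0] number [n.-1], which is below [n] because [n] is positive. *)
apply: (@leq_ltn_trans (\sum_(i : 'I_n | i != i0) 1)).
  by apply: leq_sum => i _; apply: le1.
by rewrite sum1_card cardC1 card_ord prednK.
Qed.
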